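(* Let $u,v\in\mathbb{R}$ with $0<u<v$. Then for every $q\ge1$, $$\left|A(u^{-1},v^{-1})-L^{-1}(u,v)\right|\le\frac{v-u}{2}\,A^{\frac1q}\left(|u|^{-2q},|v|^{-2q}\right).$$
   Context: For $u,v>0$: $A(u,v)=\frac{u+v}{2}$ is the arithmetic mean, and for $u\ne v$, $L(u,v)=\frac{v-u}{\log v-\log u}$ is the logarithmic mean. $L^{-1}(u,v)=1/L(u,v)$ and $A^{1/q}(a,b)=(A(a,b))^{1/q}$. *)

(* Defs.v *)
From Stdlib Require Import Reals.
Open Scope R_scope.

Definition arith_mean (u v : R) : R := (u + v) / 2.

(** Meaningful only for [0 < u], [0 < v] and [u <> v]: [ln] is [0] on
    nonpositive arguments, and the denominator vanishes when [u = v]. *)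
Definition log_mean (u v : R) : R := (v - u) / (ln v - ln u).

(* Main.v *)
Require Import Defs.
From Stdlib Require Import Reals Lra.
Open Scope R_scope.

(** Both [arith_mean (/ u) (/ v)] and [/ log_mean u v], the latter being the
    average of [1/x] over the interval from [u] to [v], lie between [1/v] and
    [1/u].  The arithmetic mean is the midpoint of that range, so the two differ
    by at most half its length, [(1/u - 1/v) / 2 = (v - u) / 2 * (1 / (u * v))].
    No integration is involved: the bounds on [/ log_mean u v] are the inequality
    [ln t <= t - 1] at [t = v/u] and [t = u/v] ([inv_log_mean_bounds]).

    It remains to bound the geometric mean [1 / (u * v)] of [u^-2] and [v^-2] by
    their power mean of exponent [q] ([geometric_le_power_mean]), which is the
    inequality of arithmetic and geometric means applied to the [q]-th powers. *)

Lemma ln_le_sub_1 (t : R) : 0 < t -> ln t <= t - 1.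
Proof.
  intros ht.
  pose proof (exp_ineq1_le (ln t)) as H.
  rewrite exp_ln in H by exact ht.
  lra.
Qed.

Lemma ln_sub_le (a b : R) : 0 < a -> 0 < b -> ln b - ln a <= (b - a) / a.
Proof.
  intros ha hb.
  pose proof (ln_le_sub_1 (b / a) (Rdiv_lt_0_compat b a hb ha)) as H.
  unfold Rdiv at 1 in H.
  rewrite ln_mult, ln_Rinv in H by auto using Rinv_0_lt_compat.
  replace ((b - a) / a) with (b / a - 1) by (field; lra).
  lra.
Qed.

Lemma inv_log_mean_bounds (u v : R) :
  0 < u -> u < v -> / v <= / log_mean u v <= / u.
Proof.
  intros hu huv.
  assert (hv : 0 < v) by lra.
  pose proof (ln_increasing u v hu huv) as hln.
  pose proof (ln_sub_le u v hu hv) as hupper.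
  pose proof (ln_sub_le v u hv hu) as hlower.
  replace (/ log_mean u v) with ((ln v - ln u) / (v - u))
    by (unfold log_mean; field; lra).
  split; apply (Rmult_le_reg_r (v - u)); try lra.
  - replace ((ln v - ln u) / (v - u) * (v - u)) with (ln v - ln u)
      by (field; lra).
    replace (/ v * (v - u)) with (- ((u - v) / v)) by (field; lra).
    lra.
  - replace ((ln v - ln u) / (v - u) * (v - u)) with (ln v - ln u)
      by (field; lra).
    replace (/ u * (v - u)) with ((v - u) / u) by (field; lra).
    exact hupper.
Qed.

(** With [a = u^-q] and [b = v^-q], the claim is the [q]-th root of
    [a * b <= (a^2 + b^2) / 2]. *)
Lemma geometric_le_power_mean (u v q : R) :
  0 < u -> 0 < v -> 0 < q ->
  / (u * v) <=
  Rpower (arith_mean (Rpower u (- 2 * q)) (Rpower v (- 2 * q))) (1 / q).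
Proof.
  intros hu hv hq.
  assert (huv : 0 < u * v) by (apply Rmult_lt_0_compat; assumption).
  replace (/ (u * v)) with (Rpower (Rpower (u * v) (- q)) (1 / q)).
  2: { rewrite Rpower_mult.
       replace (- q * (1 / q)) with (- (1)) by (field; lra).
       rewrite Rpower_Ropp, Rpower_1 by exact huv.
       reflexivity. }
  apply Rle_Rpower_l.
  - apply Rlt_le, Rdiv_lt_0_compat; lra.
  - split.
    + apply exp_pos.
    + rewrite <- Rpower_mult_distr by assumption.
      replace (- 2 * q) with (- q + - q) by ring.
      rewrite !Rpower_plus.
      unfold arith_mean.
      pose proof (Rle_0_sqr (Rpower u (- q) - Rpower v (- q))) as H.
      unfold Rsqr in H.
      lra.
Qed.

Theorem proposition4 (u v : R) (hu : 0 < u) (huv : u < v) (q : R) (hq : 1 <= q) :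
  Rabs (arith_mean (/ u) (/ v) - / log_mean u v) <=
  (v - u) / 2 *
  Rpower (arith_mean (Rpower (Rabs u) (- 2 * q)) (Rpower (Rabs v) (- 2 * q))) (1 / q).
Proof.
  assert (hv : 0 < v) by lra.
  rewrite (Rabs_pos_eq u), (Rabs_pos_eq v) by lra.
  apply Rle_trans with ((v - u) / 2 * / (u * v)).
  - pose proof (inv_log_mean_bounds u v hu huv) as hL.
    replace ((v - u) / 2 * / (u * v)) with ((/ u - / v) / 2) by (field; lra).
    unfold arith_mean.
    apply Rabs_le.
    lra.
  - apply Rmult_le_compat_l; [lra |].
    apply geometric_le_power_mean; lra.
Qed.
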